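(* Let $k,m\in\mathbb{N}$ and let $\phi: M_k \to M_m$ be a linear map. Then the following are equivalent: (i) $\phi:\operatorname{OMIN}(M_k) \to M_m$ is completely positive. (ii) $\phi$ is entanglement breaking. (iii) $\phi$ is co-entanglement breaking. (iv) $\phi: M_k \to \operatorname{OMAX}(M_m)$ is completely positive. (v) There exist $K\in\mathbb{N}$, positive linear functionals $s_l:M_k \to \mathbb{C}$ and positive matrices $P_l \in M_m$, $1 \leq l \leq K$, such that $\phi(X) = \sum_{l=1}^K s_l(X)P_l$ for all $X\in M_k$. (vi) There exist $N\in\mathbb{N}$ and rank one matrices $A_l \in M_{k,m}$, $1 \leq l \leq N$, such that $\phi(X) = \sum_{l=1}^N A_l^*XA_l$ for all $X\in M_k$. (vii) $\phi:\operatorname{OMIN}(M_k) \to \operatorname{OMAX}(M_m)$ is completely positive.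
   Context: $M_{k,m}$ denotes the complex $k\times m$ matrices, $M_n=M_{n,n}$, $M_n^+$ the positive semidefinite matrices, $I_n$ the identity matrix. $M_n(M_k)$ is identified with $M_n\otimes M_k$. Operator system structures on $M_k$: each is given by cones $M_n(\cdot)^+\subseteq M_n(M_k)_h$, $n\in\mathbb{N}$. For plain $M_k$ the cone is the usual positive semidefinite cone of $M_n(M_k)\cong M_{nk}$. For $\operatorname{OMIN}(M_k)$ it is $$C_n^{\min}(M_k)=\Big\{(v_{i,j})\in M_n(M_k): \sum_{i,j=1}^n\overline{\lambda_i}\lambda_j v_{i,j}\in M_k^+ \text{ for all }\lambda_1,\dots,\lambda_n\in\mathbb{C}\Big\}.$$ For $\operatorname{OMAX}(M_k)$ it is $$C_n^{\max}(M_k)=\{A\in M_n(M_k): rI_{nk}+A\in D_n^{\max}(M_k)\text{ for all } r>0\},$$ where $D_n^{\max}(M_k)=\{\sum_{i=1}^q a_i\otimes v_i: a_i\in M_n^+, v_i\in M_k^+, q\in\mathbb{N}\}$. A linear map $\phi$ is completely positive (with respect to given structures on domain and range) if for every $n$ the map $\phi_n((v_{i,j}))=(\phi(v_{i,j}))$ sends the $n$-th positive cone of the domain into that of the range. A positive linear functional $f$ on $M_n\otimes M_k$ is separable if it is a finite sum $\sum_i f_i\otimes g_i$ with $f_i:M_n\to\mathbb{C}$, $g_i:M_k\to\mathbb{C}$ positive linear functionals. A linear map $\phi:M_k\to M_m$ is entanglement breaking if for every $n\in\mathbb{N}$ and every state $s:M_n\otimes M_m\to\mathbb{C}$, the functional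 $s\circ\phi_n:M_n\otimes M_k\to\mathbb{C}$ is a separable positive linear functional. Let $\gamma_n:M_n\to M_n'$ (the dual space) be the linear isomorphism with $\gamma_n(E_{i,j})=\delta_{i,j}$, where $E_{i,j}$ are the matrix units and $\delta_{i,j}(E_{k,l})=1$ if $(i,j)=(k,l)$ and $0$ otherwise. For linear $\phi:M_k\to M_m$ let $\phi':M_m'\to M_k'$, $\phi'(f)=f\circ\phi$, and $\phi^\flat=\gamma_k^{-1}\circ\phi'\circ\gamma_m:M_m\to M_k$. The map $\phi$ is co-entanglement breaking if $\phi^\flat$ is entanglement breaking. *)

(* Defs.v *)
From HB Require Import structures.
From mathcomp Require Import all_boot all_order all_algebra.
From mathcomp Require Export mxtens.

Set Implicit Arguments.
Unset Strict Implicit.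
Unset Printing Implicit Defensive.

Import Order.TTheory GRing.Theory Num.Theory.
Local Open Scope ring_scope.
Local Open Scope sesquilinear_scope.

(* M_n(M_k) = M_n (x) M_k is represented by 'M[C]_(n * k), with the Kronecker
   product of mxtens as tensor product: mxtens_index (i, p) is the position of
   entry p inside block i. *)

Section Blocks.
Variable C : numClosedFieldType.

Definition blk n k (A : 'M[C]_(n * k)) (i j : 'I_n) : 'M[C]_k :=
  \matrix_(p, q) A (mxtens_index (i, p)) (mxtens_index (j, q)).

Definition blockmx n k (v : 'I_n -> 'I_n -> 'M[C]_k) : 'M[C]_(n * k) :=
  \matrix_(a, b) v (mxtens_unindex a).1 (mxtens_unindex b).1
                   (mxtens_unindex a).2 (mxtens_unindex b).2.

Lemma blockmxK n k (v : 'I_n -> 'I_n -> 'M[C]_k) i j : blk (blockmx v) i j = v i j.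
Proof. by apply/matrixP => p q; rewrite !mxE !mxtens_indexK. Qed.

Lemma blkK n k (A : 'M[C]_(n * k)) : blockmx (blk A) = A.
Proof. by apply/matrixP => a b; rewrite !mxE -!surjective_pairing !mxtens_unindexK. Qed.

Lemma blk_tens n k (a : 'M[C]_n) (v : 'M[C]_k) i j : blk (a *t v) i j = a i j *: v.
Proof. by apply/matrixP => p q; rewrite !mxE !mxtens_indexK. Qed.

Lemma blk_is_linear n k (i j : 'I_n) : linear (fun A : 'M[C]_(n * k) => blk A i j).
Proof. by move=> c A B; apply/matrixP => p q; rewrite !mxE. Qed.

End Blocks.

Section Cones.
Variable C : numClosedFieldType.

(* In C, 0 <= z means that z is real and nonnegative, and 0 < r that r is real
   and positive. *)
Definition psdmx n (A : 'M[C]_n) : Prop :=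
  A \is hermsymmx /\ forall x : 'cV[C]_n, 0 <= (x ^t* *m A *m x) 0 0.

Definition cone_usual k n (A : 'M[C]_(n * k)) : Prop := psdmx A.

Definition cone_min k n (A : 'M[C]_(n * k)) : Prop :=
  forall lam : 'I_n -> C,
    psdmx (\sum_(i < n) \sum_(j < n) ((lam i)^* * lam j) *: blk A i j).

Definition Dmax k n (A : 'M[C]_(n * k)) : Prop :=
  exists (q : nat) (a : 'I_q -> 'M[C]_n) (v : 'I_q -> 'M[C]_k),
    [/\ forall i, psdmx (a i), forall i, psdmx (v i)
      & A = \sum_(i < q) a i *t v i].

Definition cone_max k n (A : 'M[C]_(n * k)) : Prop :=
  forall r : C, 0 < r -> Dmax (r%:M + A).

End Cones.

Arguments cone_usual {C} k n A.
Arguments cone_min {C} k n A.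
Arguments cone_max {C} k n A.

Section Maps.
Variable C : numClosedFieldType.

Definition ampl n k m (phi : 'Hom('M[C]_k, 'M[C]_m)) :
    'Hom('M[C]_(n * k), 'M[C]_(n * m)) :=
  linfun (fun A => blockmx (fun i j => phi (blk A i j))).

Lemma amplE n k m (phi : 'Hom('M[C]_k, 'M[C]_m)) A :
  ampl n phi A = blockmx (fun i j => phi (blk A i j)).
Proof.
have lin : linear (fun A : 'M[C]_(n * k) => blockmx (fun i j => phi (blk A i j))).
  by move=> c X Y; apply/matrixP => a b; rewrite !mxE blk_is_linear linearP !mxE.
pose lm := GRing.isLinear.Build _ _ _ _ _ lin.
pose F : {linear 'M[C]_(n * k) -> 'M[C]_(n * m)} := HB.pack (fun A =>
  blockmx (fun i j => phi (blk A i j))) lm.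
exact: (lfunE F).
Qed.

Definition completely_positive k m
    (domcone : forall n, 'M[C]_(n * k) -> Prop)
    (rngcone : forall n, 'M[C]_(n * m) -> Prop)
    (phi : 'Hom('M[C]_k, 'M[C]_m)) : Prop :=
  forall n (A : 'M[C]_(n * k)), domcone n A -> rngcone n (ampl n phi A).

Definition functional n := 'Hom('M[C]_n, C^o).

Definition positive_functional n (f : functional n) : Prop :=
  forall A : 'M[C]_n, psdmx A -> 0 <= (f A : C).

Definition state n (s : functional n) : Prop :=
  positive_functional s /\ s 1%:M = 1.

Definition tensf n k (f : functional n) (g : functional k) : functional (n * k) :=
  linfun (fun A : 'M[C]_(n * k) => f (\matrix_(i, j) g (blk A i j))).

Lemma tensfE n k (f : functional n) (g : functional k) A :
  tensf f g A = f (\matrix_(i, j) g (blk A i j)).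
Proof.
have lin : linear (fun A : 'M[C]_(n * k) => f (\matrix_(i, j) g (blk A i j))).
  move=> c X Y; rewrite -linearP; congr (f _); apply/matrixP => a b.
  by rewrite !mxE blk_is_linear linearP.
pose lm := GRing.isLinear.Build _ _ _ _ _ lin.
pose F : {linear 'M[C]_(n * k) -> C^o} := HB.pack
  (fun A : 'M[C]_(n * k) => f (\matrix_(i, j) g (blk A i j))) lm.
exact: (lfunE F).
Qed.

Lemma tensf_tens n k (f : functional n) (g : functional k) a v :
  tensf f g (a *t v) = (f a : C) * g v.
Proof.
rewrite tensfE mulrC.
rewrite (_ : (g v : C) * f a = f ((g v : C) *: a)); last by rewrite linearZ.
congr (f _).
by apply/matrixP => i j; rewrite !mxE blk_tens linearZ mulrC.
Qed.

Definition separable n k (s : functional (n * k)) : Prop :=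
  positive_functional s /\
  exists (q : nat) (f : 'I_q -> functional n) (g : 'I_q -> functional k),
    [/\ forall i, positive_functional (f i), forall i, positive_functional (g i)
      & s = \sum_(i < q) tensf (f i) (g i)].

Definition entanglement_breaking k m (phi : 'Hom('M[C]_k, 'M[C]_m)) : Prop :=
  forall n (s : functional (n * m)), state s -> separable (s \o ampl n phi)%VF.

(* gamma_n E_ij is the functional picking entry (i, j). *)
Definition gamma n : 'Hom('M[C]_n, functional n) :=
  linfun (fun A : 'M[C]_n =>
    linfun (fun B : 'M[C]_n => (\sum_i \sum_j A i j * B i j) : C^o) : functional n).

Lemma gammaE n (A B : 'M[C]_n) :
  gamma n A B = \sum_(i < n) \sum_(j < n) A i j * B i j.
Proof.
have linB (X : 'M[C]_n) : linear (fun B : 'M[C]_n =>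
    (\sum_(i < n) \sum_(j < n) X i j * B i j) : C^o).
  move=> c Y Z; rewrite scaler_sumr -big_split; apply: eq_bigr => i _ /=.
  rewrite scaler_sumr -big_split; apply: eq_bigr => j _ /=.
  by rewrite !mxE mulrDr mulrCA.
have innerE (X Y : 'M[C]_n) : (linfun (fun B : 'M[C]_n =>
    (\sum_i \sum_j X i j * B i j) : C^o) : functional n) Y
    = \sum_(i < n) \sum_(j < n) X i j * Y i j.
  pose lm := GRing.isLinear.Build _ _ _ _ _ (linB X).
  pose F : {linear 'M[C]_n -> C^o} := HB.pack (fun B : 'M[C]_n =>
    (\sum_(i < n) \sum_(j < n) X i j * B i j) : C^o) lm.
  exact: (lfunE F).
have linA : linear (fun A : 'M[C]_n =>
    linfun (fun B : 'M[C]_n => (\sum_i \sum_j A i j * B i j) : C^o) : functional n).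
  move=> c X Y; apply/lfunP => Z.
  rewrite add_lfunE scale_lfunE !innerE scaler_sumr -big_split; apply: eq_bigr => i _ /=.
  rewrite scaler_sumr -big_split; apply: eq_bigr => j _ /=.
  by rewrite !mxE mulrDl -mulrA.
pose lm := GRing.isLinear.Build _ _ _ _ _ linA.
pose F : {linear 'M[C]_n -> functional n} := HB.pack (fun A : 'M[C]_n =>
    linfun (fun B : 'M[C]_n => (\sum_i \sum_j A i j * B i j) : C^o) : functional n) lm.
by rewrite -innerE; congr (fun_of_lfun _ B); exact: (lfunE F).
Qed.

Lemma gamma_delta n (i j k l : 'I_n) :
  gamma n (delta_mx i j) (delta_mx k l) = ((i, j) == (k, l))%:R.
Proof.
rewrite gammaE (bigD1 i) //= (bigD1 j) //= !mxE !eqxx mul1r.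
rewrite big1 ?addr0 => [|j' /negPf nj]; last by rewrite !mxE nj andbF mul0r.
rewrite big1 ?addr0 ?xpair_eqE // => i' /negPf ni.
by rewrite big1 // => j' _; rewrite !mxE ni mul0r.
Qed.

(* So (gamma n)^-1 below is a genuine inverse. *)
Lemma gamma_bij n : lker (gamma n) = 0%VS /\ limg (gamma n) = fullv.
Proof.
have ker0 : lker (gamma n) == 0%VS.
  apply/lker0P => A B eqAB; apply/matrixP => i j.
  have ev (X : 'M[C]_n) : gamma n X (delta_mx i j) = X i j.
    rewrite gammaE (bigD1 i) //= (bigD1 j) //= mxE !eqxx mulr1.
    rewrite big1 ?addr0 => [|j' /negPf nj]; last by rewrite !mxE nj andbF mulr0.
    rewrite big1 ?addr0 // => i' /negPf ni.
    by rewrite big1 // => j' _; rewrite !mxE ni mulr0.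
  by rewrite -ev eqAB ev.
split; first exact/eqP.
apply/eqP; rewrite eqEdim subvf /= limg_dim_eq ?(eqP ker0) ?capv0 //.
by rewrite !dimvf /dim /= muln1.
Qed.

Definition dual_map k m (phi : 'Hom('M[C]_k, 'M[C]_m)) :
    'Hom(functional m, functional k) :=
  linfun (fun f : functional m => (f \o phi)%VF : functional k).

Lemma dual_mapE k m (phi : 'Hom('M[C]_k, 'M[C]_m)) f : dual_map phi f = (f \o phi)%VF.
Proof.
have lin : linear (fun f : functional m => (f \o phi)%VF : functional k).
  by move=> c f1 f2; rewrite comp_lfunDl comp_lfunZl.
pose lm := GRing.isLinear.Build _ _ _ _ _ lin.
pose F : {linear functional m -> functional k} := HB.pack
  (fun f : functional m => (f \o phi)%VF : functional k) lm.
exact: (lfunE F).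
Qed.

Definition flat k m (phi : 'Hom('M[C]_k, 'M[C]_m)) : 'Hom('M[C]_m, 'M[C]_k) :=
  ((gamma k)^-1 \o dual_map phi \o gamma m)%VF.

Definition co_entanglement_breaking k m (phi : 'Hom('M[C]_k, 'M[C]_m)) : Prop :=
  entanglement_breaking (flat phi).

End Maps.

(* Main.v *)
From HB Require Import structures.
Require Import Defs.
From mathcomp Require Import all_boot all_order all_algebra.
From mathcomp Require Import reals complex mxtens.
From mathcomp Require Import boolp classical_sets topology normedtype derive.
From mathcomp Require Import ring lra.

(* Every condition is equivalent to (v), which says that the Choi matrix of phi lies
   in the cone D^max of separable matrices. For the pairing tr (H A), a matrix A
   lies in D^max as soon as it is nonnegative against every H in C^min: D^max is
   generated by the pure products (x (x) y)(x (x) y)^*, which up to scaling form a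
   compact family, and by Caratheodory boundedly many of them suffice, so the
   distance to the cone is attained and the closest point yields a separating H.
   Both (i) and (iv) give tr (H choi) >= 0 for all H in C^min, hence (v). For (ii),
   the state of the maximally entangled vector recovers phi from the separable
   functional it produces, and (iii) follows since the flat map preserves (v). *)

Set Implicit Arguments.
Unset Strict Implicit.
Unset Printing Implicit Defensive.

Import Order.TTheory GRing.Theory Num.Theory.
Import numFieldNormedType.Exports.
Local Open Scope ring_scope.
Local Open Scope sesquilinear_scope.

(** * Positive matrices and tensor products *)

Section Psd.
Variable C : numClosedFieldType.

Lemma trmxCD m n (A B : 'M[C]_(m, n)) : (A + B) ^t* = A ^t* + B ^t*.
Proof. by apply/matrixP => i j; rewrite !mxE rmorphD. Qed.

Lemma trmxCZ m n (c : C) (A : 'M[C]_(m, n)) : (c *: A) ^t* = c^* *: A ^t*.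
Proof. by apply/matrixP => i j; rewrite !mxE rmorphM. Qed.

Lemma trmxCM m n p (A : 'M[C]_(m, n)) (B : 'M[C]_(n, p)) :
  (A *m B) ^t* = B ^t* *m A ^t*.
Proof. by rewrite trmx_mul map_mxM. Qed.

Lemma trmxC_delta m n (i : 'I_m) (j : 'I_n) :
  (delta_mx i j : 'M[C]_(m, n)) ^t* = delta_mx j i.
Proof. by rewrite trmx_delta map_delta_mx. Qed.

Definition quad n (A : 'M[C]_n) (x : 'cV[C]_n) : C := (x ^t* *m A *m x) 0 0.

Lemma quadE n (A : 'M[C]_n) x :
  quad A x = \sum_i \sum_j (x i 0)^* * A i j * x j 0.
Proof.
rewrite /quad mxE exchange_big /=; apply: eq_bigr => j _.
by rewrite mxE mulr_suml; apply: eq_bigr => i _; rewrite !mxE.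
Qed.

Lemma mxtrace_mul n (A B : 'M[C]_n) : \tr (A *m B) = \sum_i \sum_j A i j * B j i.
Proof. by apply: eq_bigr => i _; rewrite mxE. Qed.

Lemma quad_tr n (A : 'M[C]_n) x : quad A x = \tr (A *m (x *m x ^t*)).
Proof. by rewrite mulmxA mxtrace_mulC mulmxA /mxtrace big_ord1. Qed.

Lemma quadD n (A B : 'M[C]_n) x : quad (A + B) x = quad A x + quad B x.
Proof. by rewrite /quad mulmxDr mulmxDl mxE. Qed.

Lemma quadZ n (c : C) (A : 'M[C]_n) x : quad (c *: A) x = c * quad A x.
Proof. by rewrite /quad -scalemxAr -scalemxAl mxE. Qed.

Lemma quad_sum n (I : finType) (A : I -> 'M[C]_n) x :
  quad (\sum_i A i) x = \sum_i quad (A i) x.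
Proof. by rewrite /quad mulmx_sumr mulmx_suml summxE. Qed.

Lemma quad_outer n (v x : 'cV[C]_n) : 0 <= quad (v *m v ^t*) x.
Proof.
have -> : quad (v *m v ^t*) x = (x ^t* *m v) 0 0 * ((x ^t* *m v) 0 0)^*.
  rewrite /quad mulmxA -mulmxA mxE big_ord1; congr (_ * _).
  by rewrite !mxE rmorph_sum; apply: eq_bigr => i _ /=; rewrite !mxE rmorphM /= conjCK mulrC.
exact: mul_conjC_ge0.
Qed.

(** Hermitian symmetry follows from nonnegativity by polarization: s u v + s v u is real, and
    testing e_a against e_b and against 'i e_b compares [A a b] with the conjugate of [A b a]. *)
Lemma psdmxP n (A : 'M[C]_n) : psdmx A <-> forall x, 0 <= quad A x.
Proof.
split=> [[_ //]|pos]; split=> //.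
pose s (u v : 'cV[C]_n) : C := (u ^t* *m A *m v) 0 0.
have sD (u v : 'cV[C]_n) : quad A (u + v) = quad A u + quad A v + (s u v + s v u).
  by rewrite /quad /s trmxCD !mulmxDl !mulmxDr !mxE; ring.
have sreal u v : s u v + s v u \is Num.real.
  have -> : s u v + s v u = quad A (u + v) - quad A u - quad A v by rewrite sD; ring.
  by rewrite !rpredB // ger0_real.
have sE a b (c : C) : s (delta_mx a 0) (c *: delta_mx b 0) = c * A a b.
  rewrite /s -scalemxAr mxE; congr (_ * _).
  rewrite trmxC_delta -rowE -colE.
  by rewrite !mxE.
have sE' a b (c : C) : s (c *: delta_mx b 0) (delta_mx a 0) = c^* * A b a.
  rewrite /s trmxCZ -!scalemxAl mxE; congr (_ * _).
  rewrite trmxC_delta -rowE -colE.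
  by rewrite !mxE.
apply/is_hermitianmxP; rewrite expr0 scale1r; apply/matrixP => a b; rewrite !mxE.
have /CrealP := sreal (delta_mx a 0) (1 *: delta_mx b 0).
have /CrealP := sreal (delta_mx a 0) ('i *: delta_mx b 0).
rewrite !sE !sE' !(rmorphD, rmorphM, conjCK, conjCi, rmorph1, mul1r) /=.
rewrite rmorphN /= !conjCi opprK.
move: (A a b) (A b a) (A a b)^* (A b a)^* => X Y X' Y' e1 e2.
have e3 : Y' - X' = X - Y.
  apply: (mulfI (neq0Ci C)); rewrite (_ : _ * (Y' - X') = - 'i * X' + 'i * Y'); last by ring.
  by rewrite e1; ring.
apply: (@mulfI _ 2%:R); first by rewrite pnatr_eq0.
rewrite (_ : 2%:R * Y' = (X' + Y') + (Y' - X')); last by ring.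
by rewrite e2 e3; ring.
Qed.

Lemma psdmx_outer n (x : 'cV[C]_n) : psdmx (x *m x ^t*).
Proof. by apply/psdmxP => y; apply: quad_outer. Qed.

(** Eigenvectors are scaled by the square roots of their eigenvalues; the latter are values of the
    quadratic form, hence nonnegative. *)
Lemma psdmx_spectral n (A : 'M[C]_n) : psdmx A ->
  exists x : 'I_n -> 'cV[C]_n, A = \sum_i x i *m (x i) ^t*.
Proof.
move=> [hA posA]; set P := spectralmx A; set d := spectral_diag A.
have uP : P \is unitarymx by apply: spectral_unitarymx.
have defA : A = P ^t* *m diag_mx d *m P.
  by rewrite -invmx_unitary //; apply/orthomx_spectralP/hermitian_normalmx.
have d_ge0 i : 0 <= d 0 i.
  have := posA (P ^t* *m delta_mx i 0).
  rewrite defA trmxCM trmxC_delta trmxCK -!mulmxA (mulmxA P) (unitarymxP uP) mul1mx.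
  rewrite (mulmxA P) (unitarymxP uP) mul1mx.
  by rewrite -rowE -colE !mxE eqxx mulr1n.
exists (fun i => sqrtC (d 0 i) *: (row i P) ^t*).
rewrite defA; apply/matrixP => a b; rewrite !mxE summxE; apply: eq_bigr => i _.
rewrite mul_mx_diag !mxE big_ord1 !mxE rmorphM /= conjCK.
rewrite (@geC0_conj _ (sqrtC _)) ?sqrtC_ge0 //.
rewrite -[d 0 i in LHS]sqrtCK; ring.
Qed.

Lemma sum_tens (V : nmodType) n k (F : 'I_(n * k) -> V) :
  \sum_a F a = \sum_i \sum_p F (mxtens_index (i, p)).
Proof.
rewrite pair_big /= (reindex (@mxtens_index n k)) /=.
  by apply: eq_bigr => -[].
by exists (@mxtens_unindex n k) => ? _; rewrite ?mxtens_indexK ?mxtens_unindexK.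
Qed.

(** The Kronecker product of two vectors, given entrywise so as to be a column, while [x *t y] has
    [1 * 1] columns. *)
Definition pvec n k (x : 'cV[C]_n) (y : 'cV[C]_k) : 'cV[C]_(n * k) :=
  \col_a (x (mxtens_unindex a).1 0 * y (mxtens_unindex a).2 0).

Lemma pvecE n k (x : 'cV[C]_n) (y : 'cV[C]_k) i p :
  pvec x y (mxtens_index (i, p)) 0 = x i 0 * y p 0.
Proof. by rewrite mxE mxtens_indexK. Qed.

Lemma tensmx_outer n k (x : 'cV[C]_n) (y : 'cV[C]_k) :
  (x *m x ^t*) *t (y *m y ^t*) = pvec x y *m (pvec x y) ^t*.
Proof.
apply/matrixP => a b; rewrite !mxE !big_ord1 !mxE rmorphM /=; ring.
Qed.

Lemma quad_tens n k (A : 'M[C]_(n * k)) w :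
  quad A w = \sum_i \sum_j \sum_p \sum_q
    (w (mxtens_index (i, p)) 0)^* * blk A i j p q * w (mxtens_index (j, q)) 0.
Proof.
rewrite quadE sum_tens; apply: eq_bigr => i _.
under eq_bigr do rewrite sum_tens.
rewrite exchange_big; apply: eq_bigr => j _; apply: eq_bigr => p _.
by apply: eq_bigr => q _; rewrite !mxE.
Qed.

Lemma quad_pvec n k (A : 'M[C]_(n * k)) x y :
  quad A (pvec x y) =
  quad (\sum_i \sum_j ((x i 0)^* * x j 0) *: blk A i j) y.
Proof.
rewrite quad_tens quad_sum; apply: eq_bigr => i _.
rewrite quad_sum; apply: eq_bigr => j _.
rewrite quadZ quadE mulr_sumr; apply: eq_bigr => p _.
rewrite mulr_sumr; apply: eq_bigr => q _.
by rewrite !pvecE rmorphM; ring.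
Qed.

(** The coefficients [lam] are the entries of x, and y tests positivity of the resulting matrix:
    C^min is the cone of block-positive matrices. *)
Lemma cone_minP n k (A : 'M[C]_(n * k)) :
  cone_min k n A <-> forall x y, 0 <= quad A (pvec x y).
Proof.
split=> [minA x y|pos lam].
  by rewrite quad_pvec; have /psdmxP := minA (fun i => x i 0).
apply/psdmxP => y; have := pos (\col_i lam i) y; rewrite quad_pvec.
congr (0 <= quad _ y); apply: eq_bigr => i _; apply: eq_bigr => j _.
by rewrite !mxE.
Qed.

Lemma blk_sum n k (I : finType) (A : I -> 'M[C]_(n * k)) i j :
  blk (\sum_l A l) i j = \sum_l blk (A l) i j.
Proof.
by apply/matrixP => p q; rewrite mxE !summxE; apply: eq_bigr => l _; rewrite mxE.
Qed.

Lemma psd_cone_min n k (A : 'M[C]_(n * k)) : psdmx A -> cone_min k n A.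
Proof. by move=> /psdmxP psdA; apply/cone_minP. Qed.

Lemma psdmxZ n (c : C) (A : 'M[C]_n) : 0 <= c -> psdmx A -> psdmx (c *: A).
Proof. by move=> c0 /psdmxP A0; apply/psdmxP => x; rewrite quadZ mulr_ge0. Qed.

Lemma psdmx_sum n (I : finType) (A : I -> 'M[C]_n) :
  (forall i, psdmx (A i)) -> psdmx (\sum_i A i).
Proof.
move=> psdA; apply/psdmxP => x; rewrite quad_sum; apply: sumr_ge0 => i _.
by have /psdmxP := psdA i.
Qed.

Lemma psdmx1 n : psdmx (1%:M : 'M[C]_n).
Proof.
apply/psdmxP => x; rewrite /quad mulmx1 mxE; apply: sumr_ge0 => i _.
by rewrite !mxE mulrC mul_conjC_ge0.
Qed.

Lemma psd_tens_outer n k (a : 'M[C]_n) (v : 'M[C]_k) : psdmx a -> psdmx v ->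
  exists (x : 'I_n -> 'cV[C]_n) (y : 'I_k -> 'cV[C]_k),
    a *t v = \sum_i \sum_j pvec (x i) (y j) *m (pvec (x i) (y j)) ^t*.
Proof.
move=> /psdmx_spectral[x ->] /psdmx_spectral[y ->]; exists x, y.
apply/matrixP => a' b'; rewrite mxE !summxE mulr_suml; apply: eq_bigr => i _.
rewrite summxE mulr_sumr; apply: eq_bigr => j _.
by rewrite -tensmx_outer [RHS]mxE.
Qed.

Lemma psdmx_tens n k (a : 'M[C]_n) (v : 'M[C]_k) :
  psdmx a -> psdmx v -> psdmx (a *t v).
Proof.
move=> psda psdv; have [x [y ->]] := psd_tens_outer psda psdv.
by apply: psdmx_sum => i; apply: psdmx_sum => j; apply: psdmx_outer.
Qed.

Lemma Dmax_psd n k (A : 'M[C]_(n * k)) : Dmax A -> psdmx A.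
Proof.
by move=> [q [a [v [psda psdv ->]]]]; apply: psdmx_sum => i; apply: psdmx_tens.
Qed.

Lemma DmaxD n k (A B : 'M[C]_(n * k)) : Dmax A -> Dmax B -> Dmax (A + B).
Proof.
move=> [q [a [v [psda psdv ->]]]] [q' [a' [v' [psda' psdv' ->]]]].
exists (q + q')%N, (fun i => match split i with inl j => a j | inr j => a' j end),
  (fun i => match split i with inl j => v j | inr j => v' j end).
split=> [i|i|]; [by case: split|by case: split|].
rewrite big_split_ord /=; congr (_ + _); apply: eq_bigr => i _.
  by rewrite (unsplitK (inl _ i)).
by rewrite (unsplitK (inr _ i)).
Qed.

Lemma Dmax_scalar n k (r : C) : 0 <= r -> Dmax (r%:M : 'M[C]_(n * k)).
Proof.
move=> r0; exists 1, (fun=> r%:M), (fun=> 1%:M); split=> [_|_|].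
- by rewrite -scalemx1; apply: psdmxZ => //; apply: psdmx1.
- exact: psdmx1.
rewrite big_ord1; apply/matrixP => a b; rewrite !mxE.
rewrite -(can_eq (@mxtens_unindexK n k)) -pair_eqE /pair_eq /=.
by case: (_ == _); rewrite /= ?mul0r // mulr1n mulr_natr.
Qed.

Lemma Dmax_cone_max n k (A : 'M[C]_(n * k)) : Dmax A -> cone_max k n A.
Proof. by move=> DA r r0; apply: DmaxD => //; apply/Dmax_scalar/ltW. Qed.

(** Replaces the limit r -> 0 by an explicit choice of r, so no topology on [C] enters. *)
Lemma ge0_of_perturb (N q : C) : 0 <= N -> (forall r, 0 < r -> 0 <= r * N + q) -> 0 <= q.
Proof.
move=> N0 pos.
have Nr : N + 1 > 0 by rewrite ltr_wpDl.
have qR : q \is Num.real.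
  have -> : q = (1 * N + q) - N by ring.
  by rewrite rpredB // ger0_real // pos.
case: (real_ge0P qR) => // q0.
(* Here r (N + 1) = - q / 2, so r N + q = q / 2 - r would be negative. *)
pose r := - q / (2%:R * (N + 1)).
have r0 : 0 < r by rewrite divr_gt0 ?oppr_gt0 ?mulr_gt0.
have := pos r r0.
have -> : r * N + q = q / 2%:R - r.
  rewrite /r; field; rewrite ?gt_eqF //.
rewrite subr_ge0 => /(lt_le_trans r0); rewrite pmulr_lgt0 ?invr_gt0 ?ltr0n // => qpos.
by have := lt_trans qpos q0; rewrite ltxx.
Qed.

Lemma cone_max_psd n k (A : 'M[C]_(n * k)) : cone_max k n A -> psdmx A.
Proof.
move=> maxA; apply/psdmxP => x; apply: (@ge0_of_perturb (quad 1%:M x)).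
  by have /psdmxP := psdmx1 (n * k).
move=> r /maxA/Dmax_psd/psdmxP/(_ x).
by rewrite quadD -(scalemx1 _ r) quadZ.
Qed.

(** Splitting both tensor factors into rank one terms turns the trace into a sum of values of the
    form of H at product vectors. *)
Lemma Dmax_pairing n k (H A : 'M[C]_(n * k)) :
  cone_min k n H -> Dmax A -> 0 <= \tr (H *m A).
Proof.
move=> /cone_minP minH [q [a [v [psda psdv ->]]]].
rewrite mulmx_sumr raddf_sum; apply: sumr_ge0 => l _ /=.
have [x [y ->]] := psd_tens_outer (psda l) (psdv l).
rewrite mulmx_sumr raddf_sum; apply: sumr_ge0 => i _ /=.
rewrite mulmx_sumr raddf_sum; apply: sumr_ge0 => j _ /=.
by rewrite -quad_tr.
Qed.

Lemma cone_min_tr n k (H : 'M[C]_(n * k)) : cone_min k n H -> 0 <= \tr H.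
Proof.
move=> minH; rewrite -[H]mulmx1; apply: Dmax_pairing => //.
exact: Dmax_scalar.
Qed.

(** The perturbation r I contributes r tr H with tr H >= 0, so it can be removed. *)
Lemma cone_max_pairing n k (H A : 'M[C]_(n * k)) :
  cone_min k n H -> cone_max k n A -> 0 <= \tr (H *m A).
Proof.
move=> minH maxA; apply: (ge0_of_perturb (cone_min_tr minH)) => r /maxA DA.
have := Dmax_pairing minH DA.
by rewrite mulmxDr mul_mx_scalar linearD linearZ.
Qed.

(** [gamma] is the bilinear pairing tr (A^T B), free of conjugation, hence the conjugate on x. *)
Lemma gamma_outer n (x : 'cV[C]_n) X :
  gamma C n (x *m x ^t*) X = quad X (map_mx Num.conj x).
Proof.
rewrite gammaE quadE; apply: eq_bigr => i _; apply: eq_bigr => j _.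
by rewrite !mxE big_ord1 !mxE conjCK; ring.
Qed.

Lemma gamma_pos n (a : 'M[C]_n) : psdmx a -> positive_functional (gamma C n a).
Proof.
move=> /psdmx_spectral[x ->] A /psdmxP A0; rewrite linear_sum sum_lfunE.
by apply: sumr_ge0 => l _; rewrite gamma_outer.
Qed.

Lemma functional_gamma n (s : functional C n) :
  s = gamma C n (\matrix_(i, j) (s (delta_mx i j) : C)).
Proof.
apply/lfunP => A; rewrite gammaE {1}(matrix_sum_delta A) linear_sum.
apply: eq_bigr => i _; rewrite linear_sum; apply: eq_bigr => j _.
by rewrite linearZ mxE mulrC.
Qed.

Lemma positive_functional_psd n (s : functional C n) : positive_functional s ->
  psdmx (\matrix_(i, j) (s (delta_mx i j) : C)).
Proof.
move=> s0; apply/psdmxP => x.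
have := s0 _ (psdmx_outer (map_mx Num.conj x)); congr (0 <= _).
rewrite [in LHS](functional_gamma s) gammaE quadE.
apply: eq_bigr => i _; apply: eq_bigr => j _.
by rewrite !mxE big_ord1 !mxE conjCK; ring.
Qed.

(** The form at x equals s applied to the very combination of blocks that C^min requires to be
    positive. *)
Lemma psdmx_compress n k (s : functional C k) (A : 'M[C]_(n * k)) :
  positive_functional s -> cone_min k n A ->
  psdmx (\matrix_(i, j) (s (blk A i j) : C)).
Proof.
move=> s0 minA; apply/psdmxP => x.
have := s0 _ (minA (fun i => x i 0)); congr (0 <= _).
rewrite linear_sum quadE; apply: eq_bigr => i _.
rewrite linear_sum; apply: eq_bigr => j _.
by rewrite linearZ mxE mulrAC.
Qed.

End Psd.

(** * Maps in Holevo form *)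

Section Holevo.
Variable C : numClosedFieldType.

Definition holevo k m (phi : 'Hom('M[C]_k, 'M[C]_m)) : Prop :=
  exists (K : nat) (s : 'I_K -> functional C k) (P : 'I_K -> 'M[C]_m),
    [/\ forall l, positive_functional (s l), forall l, psdmx (P l)
      & forall X : 'M[C]_k, phi X = \sum_(l < K) (s l X : C) *: P l].

Definition choi k m (phi : 'Hom('M[C]_k, 'M[C]_m)) : 'M[C]_(k * m) :=
  blockmx (fun i j => phi (delta_mx i j)).

(** From phi E_ij = sum_l (a_l)_ij v_l, the functionals are the [gamma] images of the first tensor
    factors. *)
Lemma holevo_of_choi k m (phi : 'Hom('M[C]_k, 'M[C]_m)) : Dmax (choi phi) -> holevo phi.
Proof.
move=> [q [a [v [psda psdv E]]]].
exists q, (fun l => gamma C k (a l)), v; split=> // [l|X]; first exact: gamma_pos.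
rewrite {1}(matrix_sum_delta X) linear_sum.
under [RHS]eq_bigr do rewrite gammaE scaler_suml.
rewrite exchange_big; apply: eq_bigr => i _ /=.
under [RHS]eq_bigr do rewrite scaler_suml.
rewrite linear_sum exchange_big; apply: eq_bigr => j _ /=.
rewrite linearZ /= -(blockmxK (fun i j => phi (delta_mx i j))) -/(choi phi) E.
rewrite blk_sum scaler_sumr; apply: eq_bigr => l _.
by rewrite blk_tens scalerA mulrC.
Qed.

Lemma holevo_ampl k m (phi : 'Hom('M[C]_k, 'M[C]_m)) K
    (s : 'I_K -> functional C k) P n (A : 'M[C]_(n * k)) :
  (forall X : 'M[C]_k, phi X = \sum_(l < K) (s l X : C) *: P l) ->
  ampl n phi A = \sum_l (\matrix_(i, j) (s l (blk A i j) : C)) *t P l.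
Proof.
move=> E; rewrite amplE; apply/matrixP => a b.
rewrite mxE E !summxE; apply: eq_bigr => l _; by rewrite !mxE.
Qed.

Lemma holevo_cp k m (phi : 'Hom('M[C]_k, 'M[C]_m)) :
  holevo phi -> completely_positive (cone_min k) (cone_max m) phi.
Proof.
move=> [K [s [P [s0 P0 E]]]] n A minA; apply: Dmax_cone_max.
rewrite (holevo_ampl _ E); exists K, (fun l => \matrix_(i, j) (s l (blk A i j) : C)), P.
by split=> // l; apply: psdmx_compress.
Qed.

(** The composed functional is the sum over l of f (. (x) P_l) (x) s_l. *)
Lemma holevo_eb k m (phi : 'Hom('M[C]_k, 'M[C]_m)) :
  holevo phi -> entanglement_breaking phi.
Proof.
move=> hol n f [f0 _]; split.
  move=> A psdA; rewrite comp_lfunE; apply: f0.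
  exact/cone_max_psd/holevo_cp/psd_cone_min.
have [K [s [P [s0 P0 E]]]] := hol.
have lin l : linear (fun B : 'M[C]_n => f (B *t P l) : C^o).
  move=> c B B'; rewrite -linearP; congr (f _).
  by apply/matrixP => a b; rewrite !mxE; ring.
pose F l : {linear 'M[C]_n -> C^o} := HB.pack (fun B : 'M[C]_n => f (B *t P l) : C^o)
  (GRing.isLinear.Build _ _ _ _ _ (lin l)).
have FE l B : linfun (F l) B = f (B *t P l) by rewrite lfunE.
exists K, (fun l => linfun (F l)), s; split=> // [l B psdB|].
  by rewrite FE; apply/f0/psdmx_tens.
apply/lfunP => A; rewrite comp_lfunE (holevo_ampl _ E) linear_sum sum_lfunE.
by apply: eq_bigr => l _; rewrite tensfE FE.
Qed.

Lemma gamma_delta_l n (B : 'M[C]_n) i j : gamma C n (delta_mx i j) B = B i j.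
Proof.
rewrite gammaE (bigD1 i) //= (bigD1 j) //= mxE !eqxx mul1r.
rewrite big1 ?addr0 => [|j' /negPf nj]; last by rewrite mxE nj andbF mul0r.
rewrite big1 ?addr0 // => i' /negPf ni.
by rewrite big1 // => j' _; rewrite !mxE ni mul0r.
Qed.

Lemma gamma_delta_r n (A : 'M[C]_n) i j : gamma C n A (delta_mx i j) = A i j.
Proof.
rewrite -[RHS]gamma_delta_l !gammaE.
by apply: eq_bigr => p _; apply: eq_bigr => q _; rewrite mulrC.
Qed.

Lemma flatE k m (phi : 'Hom('M[C]_k, 'M[C]_m)) Y i j :
  flat phi Y i j = gamma C m Y (phi (delta_mx i j)).
Proof.
have [ker0 im] := gamma_bij C k.
have gE : gamma C k (flat phi Y) = (gamma C m Y \o phi)%VF.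
  rewrite !comp_lfunE limg_lfunVK ?im ?memvf //; exact: dual_mapE.
by rewrite -[LHS]gamma_delta_r gE comp_lfunE.
Qed.

(** [flat] is transposition for the symmetric bilinear pairing tr (A^T B). *)
Lemma flatK k m (phi : 'Hom('M[C]_k, 'M[C]_m)) : flat (flat phi) = phi.
Proof.
apply/lfunP => X; apply/matrixP => p q; rewrite flatE gammaE.
rewrite {2}(matrix_sum_delta X) linear_sum summxE; apply: eq_bigr => i _.
rewrite linear_sum summxE; apply: eq_bigr => j _.
by rewrite linearZ [RHS]mxE flatE gamma_delta_l.
Qed.

(** Transposing a term swaps its two ingredients: P_l becomes a functional through [gamma], and s_l
    becomes its matrix of values. *)
Lemma holevo_flat k m (phi : 'Hom('M[C]_k, 'M[C]_m)) : holevo phi -> holevo (flat phi).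
Proof.
move=> [K [s [P [s0 P0 E]]]].
exists K, (fun l => gamma C m (P l)), (fun l => \matrix_(i, j) (s l (delta_mx i j) : C)).
split=> [l|l|Y]; [exact: gamma_pos|exact: positive_functional_psd|].
apply/matrixP => i j; rewrite flatE gammaE summxE.
under [RHS]eq_bigr do rewrite !mxE gammaE mulr_suml.
rewrite [RHS]exchange_big; apply: eq_bigr => p _ /=.
under [RHS]eq_bigr do rewrite mulr_suml.
rewrite [RHS]exchange_big; apply: eq_bigr => q _ /=.
rewrite E summxE mulr_sumr; apply: eq_bigr => l _.
by rewrite mxE; ring.
Qed.

Lemma rank1_outer m n (A : 'M[C]_(m, n)) : \rank A = 1%N ->
  exists (x : 'cV[C]_m) (y : 'cV[C]_n), A = x *m y ^t*.
Proof.
move=> rA; have := mulmx_base A; move: (col_base A) (row_base A); rewrite rA => x y <-.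
by exists x, (y ^t*); rewrite trmxCK.
Qed.

Lemma rank_outer m n (x : 'cV[C]_m) (y : 'cV[C]_n) :
  x *m y ^t* != 0 -> \rank (x *m y ^t*) = 1%N.
Proof.
move=> nz; apply/eqP; rewrite eqn_leq lt0n mxrank_eq0 nz andbT.
exact: leq_trans (mxrankM_maxl _ _) (rank_leq_col _).
Qed.

(** A rank one Kraus operator acts as a positive functional times a positive matrix, which links (v)
    and (vi). *)
Lemma outer_conj m n (x : 'cV[C]_m) (y : 'cV[C]_n) X :
  (x *m y ^t*) ^t* *m X *m (x *m y ^t*) =  quad X x *: (y *m y ^t*).
Proof.
rewrite trmxCM trmxCK -!mulmxA (mulmxA X) (mulmxA (x ^t*)) (mulmxA (x ^t*)).
by rewrite [x ^t* *m X *m x]mx11_scalar mul_scalar_mx -scalemxAr.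
Qed.

Definition kraus1 k m (phi : 'Hom('M[C]_k, 'M[C]_m)) : Prop :=
  exists (N : nat) (A : 'I_N -> 'M[C]_(k, m)),
    (forall l, \rank (A l) = 1%N) /\
    (forall X : 'M[C]_k, phi X = \sum_(l < N) (A l) ^t* *m X *m A l).

Lemma kraus1_holevo k m (phi : 'Hom('M[C]_k, 'M[C]_m)) : kraus1 phi -> holevo phi.
Proof.
move=> [N [A [rA E]]].
have /boolp.choice[x /boolp.choice[y defA]] l := rank1_outer (rA l).
exists N, (fun l => gamma C k (map_mx Num.conj (x l) *m (map_mx Num.conj (x l)) ^t*)),
  (fun l => y l *m (y l) ^t*).
split=> [l|l|X]; [exact/gamma_pos/psdmx_outer|exact: psdmx_outer|].
rewrite E; apply: eq_bigr => l _; rewrite defA outer_conj; congr (_ *: _).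
by rewrite gamma_outer map_mxCK.
Qed.

Lemma holevo_kraus1 k m (phi : 'Hom('M[C]_k, 'M[C]_m)) : holevo phi -> kraus1 phi.
Proof.
move=> [K [s [P [s0 P0 E]]]].
have /boolp.choice[y defP] l := psdmx_spectral (P0 l).
have /boolp.choice[x defs] l := psdmx_spectral (positive_functional_psd (s0 l)).
(* One operator for each pair of spectral terms of s_l and P_l; the conjugate matches
   [gamma_outer]. *)
pose B (t : 'I_K * ('I_k * 'I_m)) :=
  map_mx Num.conj (x t.1 t.2.1) *m (y t.1 t.2.2) ^t*.
(* Vanishing products are discarded, as (vi) asks for rank exactly one. *)
pose S := [set t | B t != 0].
exists #|S|, (fun l => B (enum_val l)); split=> [l|X].
  by have := enum_valP l; rewrite inE; apply: rank_outer.
rewrite -(big_enum_val (fun t => B t ^t* *m X *m B t)) /=.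
rewrite (eq_bigl (fun t => B t != 0)) => [|t]; last by rewrite inE.
rewrite big_mkcond /=.
under eq_bigr => t _.
  rewrite (_ : (if _ then _ else _) = B t ^t* *m X *m B t); last first.
    by case: eqP => //= ->; rewrite mulmx0.
  rewrite /B outer_conj; over.
rewrite E -(pair_bigA _ (fun l ij => quad X (map_mx Num.conj (x l ij.1)) *:
  (y l ij.2 *m (y l ij.2) ^t*))) /=; apply: eq_bigr => l _.
rewrite -(pair_bigA _ (fun i j => quad X (map_mx Num.conj (x l i)) *:
  (y l j *m (y l j) ^t*))) /=.
under eq_bigr do rewrite -scaler_sumr -defP.
rewrite -scaler_suml; congr (_ *: _).
rewrite [in LHS](functional_gamma (s l)) defs linear_sum sum_lfunE.
by apply: eq_bigr => i _; rewrite gamma_outer.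
Qed.

End Holevo.

(** * The Choi matrix and the maximally entangled vector *)

Section Choi.
Variable C : numClosedFieldType.

(** The vector sum_i e_i (x) e_i, left unnormalized: its squared norm is n. *)
Definition max_entangled n : 'cV[C]_(n * n) :=
  \col_a ((mxtens_unindex a).1 == (mxtens_unindex a).2)%:R.

Lemma quad_max_entangled n (B : 'M[C]_(n * n)) :
  quad B (max_entangled n) = \sum_i \sum_j blk B i j i j.
Proof.
rewrite quad_tens; apply: eq_bigr => i _; apply: eq_bigr => j _.
rewrite (bigD1 i) //= [X in _ + X]big1 ?addr0 => [|p /negPf pi].
  rewrite (bigD1 j) //= [X in _ + X]big1 ?addr0 => [|q /negPf qj].
    by rewrite !mxE !mxtens_indexK !eqxx conjC1 mulr1 mul1r.
  by rewrite !mxE !mxtens_indexK /= (eq_sym j) qj mulr0.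
by rewrite big1 // => q _; rewrite !mxE !mxtens_indexK /= (eq_sym i) pi conjC0 !mul0r.
Qed.

Lemma cp_min_choi k m (phi : 'Hom('M[C]_k, 'M[C]_m)) (H : 'M[C]_(k * m)) :
  completely_positive (cone_min k) (cone_usual m) phi ->
  cone_min m k H -> 0 <= \tr (H *m choi phi).
Proof.
move=> cp /cone_minP minH.
(* V is the transpose of H with its tensor factors swapped, so that
   tr (H choi) is the value of phi_m(V) at the maximally entangled vector. *)
pose V : 'M[C]_(m * k) := blockmx (fun p q => \matrix_(i, j)
  H (mxtens_index (j, q)) (mxtens_index (i, p))).
have minV : cone_min k m V.
  apply/cone_minP => y x.
  (* Transposing the matrix conjugates the test vector, and swapping the factors exchanges x and
     y. *)
  have := minH (map_mx Num.conj x) (map_mx Num.conj y); congr (0 <= _).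
  apply: esym; rewrite [RHS]quadE [RHS]exchange_big sum_tens [RHS]exchange_big /=.
  rewrite [LHS]quadE sum_tens.
  apply: eq_bigr => p _; apply: eq_bigr => i _.
  rewrite !sum_tens [RHS]exchange_big; apply: eq_bigr => q _; apply: eq_bigr => j _.
  by rewrite !pvecE !mxE !mxtens_indexK /= !rmorphM /= !conjCK; ring.
have /psdmxP/(_ (max_entangled m)) := cp _ _ minV; congr (0 <= _).
rewrite quad_max_entangled mxtrace_mulC mxtrace_mul sum_tens [RHS]exchange_big /=.
apply: eq_bigr => p _; under [RHS]eq_bigr do rewrite sum_tens exchange_big /=.
rewrite [RHS]exchange_big; apply: eq_bigr => q _ /=.
rewrite amplE !blockmxK {1}(matrix_sum_delta (\matrix_(i, j) _)) linear_sum summxE.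
apply: eq_bigr => i _; rewrite linear_sum summxE; apply: eq_bigr => j _.
by rewrite linearZ !mxE !mxtens_indexK mulrC.
Qed.

(** On phi_m (E_pr (x) X) the maximally entangled state returns the entry (p, r) of phi X divided by
    m, so a separable decomposition can be read off as a Holevo form. *)
Lemma eb_holevo k m (phi : 'Hom('M[C]_k, 'M[C]_m)) :
  entanglement_breaking phi -> holevo phi.
Proof.
(* For m = 0 there is no state to use, but all values of phi are empty matrices. *)
case: m phi => [|m] phi eb.
  exists 0%N, (fun=> 0), (fun=> 0); split=> [[]|[]|X] //.
  by rewrite big_ord0; apply: flatmx0.
set m1 := m.+1 in phi eb *.
pose c : C := m1%:R^-1.
have lin : linear (fun B : 'M[C]_(m1 * m1) => c * quad B (max_entangled m1) : C^o).
  by move=> a B B'; rewrite quadD quadZ mulrDr mulrCA.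
pose F : {linear 'M[C]_(m1 * m1) -> C^o} := HB.pack
  (fun B : 'M[C]_(m1 * m1) => c * quad B (max_entangled m1) : C^o)
  (GRing.isLinear.Build _ _ _ _ _ lin).
have sE B : linfun F B = c * quad B (max_entangled m1) by rewrite lfunE.
have m1_neq0 : m1%:R != 0 :> C by rewrite pnatr_eq0.
have [|_ [q [f [g [f0 g0 E]]]]] := eb m1 (linfun F).
  split=> [B /psdmxP B0|]; first by rewrite sE mulr_ge0 // invr_ge0 ler0n.
  rewrite sE quad_max_entangled (eq_bigr (fun=> 1)) => [|i _].
    by rewrite sumr_const card_ord mulVf.
  rewrite (bigD1 i) //= big1 ?addr0 => [|j /negPf ji]; rewrite !mxE.
    by rewrite eqxx.
  by rewrite (can_eq (@mxtens_indexK _ _)) xpair_eqE eq_sym ji.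
(* The factor m cancels the normalization c of the state. *)
exists q, g, (fun l => m1%:R *: \matrix_(i, j) (f l (delta_mx i j) : C)).
split=> // [l|X].
  by apply: psdmxZ; rewrite ?ler0n //; apply: positive_functional_psd.
apply/matrixP => p r; rewrite summxE.
have := congr1 (fun h : functional C (m1 * k) => h (delta_mx p r *t X)) E.
rewrite /= comp_lfunE sE sum_lfunE amplE quad_max_entangled.
have -> : \sum_i \sum_j blk (blockmx (fun i j => phi (blk (delta_mx p r *t X) i j))) i j i j
   = phi X p r.
  rewrite -[RHS]gamma_delta_l gammaE; apply: eq_bigr => i _; apply: eq_bigr => j _.
  by rewrite blockmxK blk_tens linearZ mxE.
move=> /(congr1 ( *%R m1%:R)); rewrite mulVKf // => ->.
rewrite mulr_sumr; apply: eq_bigr => l _.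
by rewrite tensf_tens !mxE; ring.
Qed.
Lemma tr_ctrmx n (B : 'M[C]_n) : \tr (B ^t*) = (\tr B)^*.
Proof. by rewrite rmorph_sum; apply: eq_bigr => i _; rewrite !mxE. Qed.

Lemma tr_ctrmxM n (A B : 'M[C]_n) : A ^t* = A ->
  \tr (B ^t* *m A) = (\tr (B *m A))^*.
Proof. by move=> hA; rewrite -tr_ctrmx trmxCM hA mxtrace_mulC. Qed.

End Choi.

(** * Farkas' lemma for a cone with compact base *)

Lemma sum_split (V : nmodType) (T : Type) n1 n2 (x : 'I_n1 -> T) (y : 'I_n2 -> T)
    (F : T -> V) :
  \sum_i F (match split i with inl j => x j | inr j => y j end) =
  \sum_i F (x i) + \sum_i F (y i).
Proof.
rewrite big_split_ord; congr (_ + _); apply: eq_bigr => i _.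
  by rewrite (unsplitK (inl i)).
by rewrite (unsplitK (inr i)).
Qed.

(** The elimination step of Caratheodory: more vectors than coordinates satisfy a linear relation,
    and subtracting a suitable multiple of it from the sum cancels one vector while keeping the
    coefficients nonnegative. *)
Lemma conic_dependence (F : realFieldType) (J : finType) n
    (x : 'I_n.+1 -> J -> F) : (#|J| <= n)%N ->
  exists (i0 : 'I_n.+1) (c : 'I_n.+1 -> F),
    [/\ forall i, 0 <= c i, c i0 = 0
      & forall j, \sum_i c i * x i j = \sum_i x i j].
Proof.
move=> leJn; pose M := \matrix_(i < n.+1, j < #|J|) x i (enum_val j).
have /rowV0Pn [v /sub_kermxP vM v0] : kermx M != 0.
  by rewrite -mxrank_eq0 mxrank_ker subn_eq0 -ltnNge (leq_ltn_trans (rank_leq_col M)).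
have {vM} vx j : \sum_i v 0 i * x i j = 0.
  have /rowP/(_ (enum_rank j)) := vM; rewrite !mxE; apply: etrans.
  by apply: eq_bigr => i _; rewrite mxE enum_rankK.
have [u [i1 ui1] ux] : exists2 u : 'I_n.+1 -> F,
    exists i1, 0 < u i1 & forall j, \sum_i u i * x i j = 0.
  have [i1 vi1] : exists i1, v 0 i1 != 0 by apply/rV0Pn.
  case: (ltrgtP (v 0 i1) 0) vi1 => // vi1 _; last by exists (v 0) => //; exists i1.
  exists (fun i => - v 0 i) => [|j]; first by exists i1; rewrite oppr_gt0.
  by under eq_bigr do rewrite mulNr; rewrite sumrN vx oppr0.
(* Dividing by the largest, positive, u_i keeps every 1 - u_i / u_i0 nonnegative. *)
pose i0 := [arg max_(i > i1) u i]%O.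
have max0 i : u i <= u i0 by rewrite /i0; case: Order.TotalTheory.arg_maxP => // k _; apply.
have ui0 : 0 < u i0 by apply: lt_le_trans (max0 i1).
exists i0, (fun i => 1 - u i / u i0); split => [i||j].
- by rewrite subr_ge0 ler_pdivrMr // mul1r.
- by rewrite divff ?subrr // gt_eqF.
have E i : (1 - u i / u i0) * x i j = x i j - (u i0)^-1 * (u i * x i j) by ring.
under eq_bigr do rewrite E.
by rewrite sumrB -mulr_sumr ux mulr0 subr0.
Qed.

Lemma continuous_sumr (R : realType) (T : topologicalType) (I : finType) (F : I -> T -> R) :
  (forall i, continuous (F i)) -> continuous (fun x => \sum_i F i x).
Proof.
move=> Fc; apply: (@continuous_big _ _ _ _ predT) => // x.
exact: (@add_continuous R).
Qed.

Section Farkas.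
Local Open Scope classical_set_scope.
Local Open Scope ring_scope.
(** The cone consists of the finite sums of vectors [G z]; scalars are absorbed into z by [Gscale],
    and scaling [z0] by 0 provides the origin. *)
Variables (R : realType) (J : finType) (T : topologicalType) (G : T -> J -> R) (z0 : T).
Hypothesis Gcont : forall j, continuous (fun z => G z j).
Hypothesis Gscale : forall (c : R) z, 0 <= c -> exists z', forall j, G z' j = c * G z j.

Lemma conic_caratheodory n (z : 'I_n -> T) : (#|J| <= n)%N ->
  exists z' : 'I_#|J| -> T, forall j, \sum_i G (z' i) j = \sum_i G (z i) j.
Proof.
elim: n => [|n IHn] in z *; rewrite leq_eqVlt => /orP[/eqP eJ|].
- by move: z; rewrite -eJ => z; exists z.
- by [].
- by move: z; rewrite -eJ => z; exists z.
rewrite ltnS => leJn.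
have [i0 [c [c0 ci0 cG]]] := conic_dependence (fun i => G (z i)) leJn.
have /choice[z' z'E] i := Gscale (z i) (c0 i).
have [z2 z2E] := IHn (fun i => z' (lift i0 i)) leJn.
exists z2 => j; rewrite z2E -cG (bigD1_ord i0) //= ci0 mul0r add0r.
by apply: eq_bigr => i _; rewrite z'E.
Qed.

(* tau is a linear form with respect to which the cone has a compact base. *)
Variable tau : J -> R.
Let trG z := \sum_j tau j * G z j.
Hypothesis tr_ge0 : forall z, 0 <= trG z.
Hypothesis tr_proper : forall M, exists2 B : set T, compact B &
  forall z, trG z <= M -> exists2 z', B z' & forall j, G z' j = G z j.

Let D := #|J|.
Let sumG (Z : 'I_D -> T) j := \sum_i G (Z i) j.
Let sqdist (f g : J -> R) := \sum_j (f j - g j) ^+ 2.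

Local Notation tuples := (prod_topology (fun _ : 'I_D => T)).

Lemma continuous_sqdist f : continuous (fun Z : tuples => sqdist f (sumG Z)).
Proof.
apply: continuous_sumr => j.
have cj : continuous (fun Z : tuples => f j - sumG Z j).
  move=> Z; apply: continuousB; first exact: cst_continuous.
  apply: (@continuous_sumr _ _ _ (fun i (Z : tuples) => G (Z i) j)) => i {}Z.
  apply: (@continuous_comp _ _ _ (fun Z : tuples => Z i) (fun z => G z j)).
    exact: (@proj_continuous _ (fun _ : 'I_D => T) i).
  exact: Gcont.
by move=> Z; apply: (continuousM (cj Z) (cj Z)).
Qed.

(** Points no farther from f than the origin form a bounded set, on which the linear form tau is
    bounded. *)
Lemma tr_bounded f : exists M, forall g, sqdist f g <= sqdist f (fun=> 0) ->
  \sum_j tau j * g j <= M.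
Proof.
set r := sqdist f _; exists (\sum_j `|tau j| * (`|f j| + (r + 1))) => g gr.
apply: ler_sum => j _; apply: le_trans (ler_norm _) _.
rewrite normrM ler_wpM2l //.
have fgj : (f j - g j) ^+ 2 <= r.
  apply: le_trans gr; rewrite /sqdist (bigD1 j) //= lerDl.
  by apply: sumr_ge0 => i _; apply: sqr_ge0.
(* The bound r + 1 stands in for the square root of r. *)
have fg : `|f j - g j| <= r + 1.
  rewrite -real_normK ?num_real // in fgj.
  by have := normr_ge0 (f j - g j); nra.
have -> : g j = f j - (f j - g j) by ring.
by apply: le_trans (ler_normB _ _) _; rewrite lerD2l.
Qed.

(** Only sums at least as close to f as the origin compete; with [D] terms and bounded tau they are
    represented in a compact power of B, where the continuous distance attains its minimum. *)
Lemma closest_sum f : exists n (Z : 'I_n -> T), forall n' (Z' : 'I_n' -> T),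
  sqdist f (fun j => \sum_i G (Z i) j) <= sqdist f (fun j => \sum_i G (Z' i) j).
Proof.
have [M trM] := tr_bounded f.
(* The maximum with 0 makes B contain a representative of the origin. *)
have [B cB properB] := tr_proper (Num.max M 0).
have [o o0] := Gscale z0 (lexx 0).
have [o' Bo' o'0] : exists2 o', B o' & forall j, G o' j = 0.
  have [|o' Bo' o'E] := properB o.
    rewrite /trG big1 ?le_max ?lexx ?orbT // => j _.
    by rewrite o0 mul0r mulr0.
  by exists o' => // j; rewrite o'E o0 mul0r.
have cBD := @tychonoff _ (fun _ : 'I_D => T) (fun=> B) (fun=> cB).
have [|Z BZ minZ] := compact_EVT_min _ cBD (continuous_subspaceT (continuous_sqdist (f := f))).
  by exists (fun=> o').
exists D, Z => n' Z'.
have [rltn|rgen] := ltP (sqdist f (fun=> 0)) (sqdist f (fun j => \sum_i G (Z' i) j)).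
  apply: le_trans (ltW rltn).
  have := minZ (fun=> o'); rewrite inE => /(_ (fun=> Bo')).
  congr (_ <= _); apply: eq_bigr => j _; rewrite /sumG big1 // => i _.
have [Z2 Z2E] : exists Z2 : 'I_D -> T, forall j, \sum_i G (Z2 i) j = \sum_i G (Z' i) j.
  (* Padding with [D] zero terms provides enough terms for the reduction to exactly [D]. *)
  have leD : (#|J| <= n' + D)%N by apply: leq_addl.
  pose Z1 (i : 'I_(n' + D)) := match split i with inl i' => Z' i' | inr _ => o' end.
  have [Z2 Z2E] := conic_caratheodory Z1 leD.
  exists Z2 => j; rewrite Z2E (sum_split Z' (fun=> o') (fun z => G z j)).
  by rewrite [X in _ + X]big1 ?addr0.
(* As all terms have nonnegative tau, each is bounded by the total. *)
have trZ2 i : trG (Z2 i) <= Num.max M 0.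
  rewrite le_max; apply/orP; left; apply: le_trans (trM _ rgen).
  have -> : \sum_j tau j * \sum_i G (Z' i) j = \sum_i trG (Z2 i).
    rewrite /trG exchange_big; apply: eq_bigr => j _ /=.
    by rewrite -mulr_sumr Z2E.
  by rewrite [leRHS](bigD1 i) //= lerDl sumr_ge0.
have /choice[Z3 Z3P] i : exists z, B z /\ forall j, G z j = G (Z2 i) j.
  by have [z] := properB _ (trZ2 i); exists z.
have := minZ Z3; rewrite inE => /(_ (fun i => (Z3P i).1)); congr (_ <= _).
apply: eq_bigr => j _; rewrite /sumG -Z2E; congr ((_ - _) ^+ 2).
by apply: eq_bigr => i _; rewrite (Z3P i).2.
Qed.

(** The first order condition at a minimum; if a < 0, the chosen t makes t |b| < - a / 2, so a + t b
    < 0. *)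
Lemma pos_coef_ge0 (a b : R) :
  (forall t, 0 < t -> t <= 1 -> 0 <= t * a + t ^+ 2 * b) -> 0 <= a.
Proof.
move=> pos; have [//|a_lt0] := leP 0 a.
pose t := Num.min 1 (- a / (2 * (`|b| + 1))).
have b1 : 0 < 2 * (`|b| + 1) by rewrite mulr_gt0 // ltr_wpDl.
have t0 : 0 < t by rewrite lt_min ltr01 divr_gt0 // oppr_gt0.
have t1 : t <= 1 by rewrite ge_min lexx.
have tb : t * (2 * (`|b| + 1)) <= - a by rewrite -ler_pdivlMr // ge_min lexx orbT.
have := pos t t0 t1; rewrite expr2 -mulrA -mulrDr pmulr_rge0 // => ab.
have := ler_norm b; have := normr_ge0 b; nra.
Qed.

Lemma conic_farkas f :
  (exists n (Z : 'I_n -> T), forall j, f j = \sum_i G (Z i) j) \/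
  (exists y : J -> R, (forall z, 0 <= \sum_j y j * G z j) /\ \sum_j y j * f j < 0).
Proof.
(* The separating vector is p - f with p the point of the cone closest to f. *)
have [n [Z minZ]] := closest_sum f.
pose p j := \sum_i G (Z i) j.
have [fp|/existsNP[j0 /eqP fpj0]] := pselect (forall j, f j = p j); first by left; exists n, Z.
right; exists (fun j => p j - f j).
have step g t : sqdist f (fun j => p j + t * g j) =
    sqdist f p + (t * (2 * \sum_j (p j - f j) * g j) + t ^+ 2 * \sum_j g j ^+ 2).
  by rewrite /sqdist !mulr_sumr -!big_split; apply: eq_bigr => j _ /=; ring.
(* Moving from p to p + t G z stays in the cone, so the first order term is nonnegative. *)
have dual z : 0 <= \sum_j (p j - f j) * G z j.
  rewrite -(@pmulr_rge0 _ 2) //; apply: (@pos_coef_ge0 _ (\sum_j G z j ^+ 2)) => t t0 _.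
  rewrite -(lerDl (sqdist f p)) -step.
  have [z' z'E] := Gscale z (ltW t0).
  pose Z' (i : 'I_(n + 1)) := match split i with inl i' => Z i' | inr _ => z' end.
  have := minZ _ Z'; congr (_ <= _); apply: eq_bigr => j _; congr ((_ - _) ^+ 2).
  by rewrite (sum_split Z (fun=> z') (fun z => G z j)) big_ord1 z'E.
(* Moving towards the origin, to (1 - t) p with t <= 1, also stays in the cone. *)
have dualp : \sum_j (p j - f j) * p j <= 0.
  rewrite -oppr_ge0 -(@pmulr_rge0 _ 2) //.
  apply: (@pos_coef_ge0 _ (\sum_j p j ^+ 2)) => t t0 t1.
  have -> : t * (2 * - \sum_j (p j - f j) * p j) =
    - t * (2 * \sum_j (p j - f j) * p j) by ring.
  rewrite -[t ^+ 2]sqrrN -(lerDl (sqdist f p)) -step.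
  have t1' : 0 <= 1 - t by rewrite subr_ge0.
  have /choice[Z' Z'E] i := Gscale (Z i) t1'.
  have := minZ _ Z'; congr (_ <= _); apply: eq_bigr => j _; congr ((_ - _) ^+ 2).
  under eq_bigr do rewrite Z'E.
  by rewrite -mulr_sumr -/(p j); ring.
split=> //; have -> : \sum_j (p j - f j) * f j =
    \sum_j (p j - f j) * p j - sqdist f p.
  by rewrite -sumrB; apply: eq_bigr => j _; ring.
rewrite subr_lt0; apply: le_lt_trans dualp _.
rewrite /sqdist (bigD1 j0) //= ltr_pwDl ?exprn_even_gt0 ?subr_eq0 //.
by apply: sumr_ge0 => i _; apply: sqr_ge0.
Qed.

End Farkas.

(** * Duality between block-positive and separable matrices *)

Section Separation.
Local Open Scope classical_set_scope.
Local Open Scope ring_scope.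
Variable R : realType.
Local Notation C := R[i].
Local Notation re := (@complex.Re R).
Local Notation im := (@complex.Im R).

Lemma ReM (u v : C) : re (u * v) = re u * re v - im u * im v.
Proof. by case: u v => [a b] [c d]. Qed.

Lemma ImM (u v : C) : im (u * v) = re u * im v + im u * re v.
Proof. by case: u v => [a b] [c d]. Qed.

Lemma ReJ (u : C) : re u^* = re u.
Proof. by case: u. Qed.

Lemma ImJ (u : C) : im u^* = - im u.
Proof. by case: u. Qed.

Lemma ReD (u v : C) : re (u + v) = re u + re v.
Proof. by case: u v => [a b] [c d]. Qed.

Lemma Re_sum (I : finType) (F : I -> C) : re (\sum_i F i) = \sum_i re (F i).
Proof. exact: (big_morph re ReD). Qed.

Lemma addJ_Re (u : C) : u + u^* = (re u *+ 2)%:C%C.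
Proof. by case: u => a b; apply/eqP; rewrite eq_complex /= mulr2n subrr !eqxx. Qed.

Lemma sum_pair (I1 I2 : finType) (F : I1 * I2 -> R) :
  \sum_p F p = \sum_i \sum_j F (i, j).
Proof. by rewrite pair_bigA; apply: eq_bigr => -[]. Qed.

(** * Real coordinates of complex matrices *)

Section Pairing.
Variable N : nat.
Local Notation J := ('I_N * 'I_N * bool)%type.

Definition coord (A : 'M[C]_N) (j : J) : R :=
  if j.2 then re (A j.1.1 j.1.2) else im (A j.1.1 j.1.2).

Lemma coord_inj A B : (forall j, coord A j = coord B j) -> A = B.
Proof.
move=> AB; apply/matrixP => a b; apply/eqP; rewrite eq_complex.
have := AB (a, b, true); have := AB (a, b, false).
by rewrite /coord /= => -> ->; rewrite !eqxx.
Qed.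

Lemma coord_sum (I : finType) (A : I -> 'M[C]_N) j :
  coord (\sum_i A i) j = \sum_i coord (A i) j.
Proof.
rewrite /coord summxE; case: j.2; first exact: Re_sum.
by apply: (big_morph im) => [[a b] [c d]|].
Qed.

Lemma coordZ (r : R) (A : 'M[C]_N) j : coord (r%:C%C *: A) j = r * coord A j.
Proof.
by rewrite /coord mxE; case: j.2; rewrite ?ReM ?ImM /= mul0r ?subr0 ?addr0.
Qed.

(** Transposed and conjugated so that the real form y becomes A |-> Re tr ([form_mx y] A). *)
Definition form_mx (y : J -> R) : 'M[C]_N :=
  \matrix_(a, b) (y (b, a, true) -i* y (b, a, false))%C.

Lemma form_mxE y A : \sum_j y j * coord A j = re (\tr (form_mx y *m A)).
Proof.
rewrite mxtrace_mul exchange_big Re_sum.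
rewrite !sum_pair.
apply: eq_bigr => a _; rewrite Re_sum; apply: eq_bigr => b _.
by rewrite big_bool /= ReM mxE /= mulNr opprK.
Qed.

End Pairing.

Definition cplx_continuous (T : topologicalType) (f : T -> C) :=
  continuous (re \o f) /\ continuous (im \o f).

Lemma cplx_continuousM (T : topologicalType) (f g : T -> C) :
  cplx_continuous f -> cplx_continuous g -> cplx_continuous (fun z => f z * g z).
Proof.
move=> [rf jf] [rg jg]; split.
  rewrite (_ : _ \o _ = (fun z => re (f z) * re (g z) - im (f z) * im (g z))).
    move=> z; apply: cvgB; apply: cvgM; [exact: rf|exact: rg|exact: jf|exact: jg].
  by apply/funext => z; rewrite /= ReM.
rewrite (_ : _ \o _ = (fun z => re (f z) * im (g z) + im (f z) * re (g z))).
  move=> z; apply: cvgD; apply: cvgM; [exact: rf|exact: jg|exact: jf|exact: rg].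
by apply/funext => z; rewrite /= ImM.
Qed.

Lemma cplx_continuousJ (T : topologicalType) (f : T -> C) :
  cplx_continuous f -> cplx_continuous (fun z => (f z)^*).
Proof.
move=> [rf jf]; split.
  by rewrite (_ : _ \o _ = re \o f) //; apply/funext => z; rewrite /= ReJ.
rewrite (_ : _ \o _ = (fun z => - im (f z))).
  by move=> z; apply: cvgN; exact: jf.
by apply/funext => z; rewrite /= ImJ.
Qed.

(** * Pure product matrices and their compact base *)

Section Params.
Variables n k : nat.
Local Notation I := ('I_n * bool + 'I_k * bool)%type.
Local Notation T := (prod_topology (fun _ : I => R)).

Definition param_x (z : T) : 'cV[C]_n := \col_i (z (inl (i, true)) +i* z (inl (i, false)))%C.
Definition param_y (z : T) : 'cV[C]_k := \col_i (z (inr (i, true)) +i* z (inr (i, false)))%C.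
Definition param_outer (z : T) : 'M[C]_(n * k) :=
  pvec (param_x z) (param_y z) *m (pvec (param_x z) (param_y z)) ^t*.

Lemma param_surj x y : exists z, param_x z = x /\ param_y z = y.
Proof.
exists (fun i => match i with
  | inl (i, t) => if t then re (x i 0) else im (x i 0)
  | inr (i, t) => if t then re (y i 0) else im (y i 0) end).
by split; apply/colP => i; rewrite mxE /=; [case: (x i 0)|case: (y i 0)].
Qed.

(** Separate factors for x and y: only their product affects the outer product, so norm can be
    shifted from one vector to the other. *)
Definition rescale (a b : R) (z : T) : T :=
  fun i => match i with inl _ => a * z i | inr _ => b * z i end.

Lemma param_rescale a b z :
  param_outer (rescale a b z) = (((a * b) ^+ 2)%:C)%C *: param_outer z.
Proof.
have rx : param_x (rescale a b z) = a%:C%C *: param_x z.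
  by apply/colP => i; apply/eqP; rewrite eq_complex !mxE ReM ImM /= !mul0r subr0 addr0 !eqxx.
have ry : param_y (rescale a b z) = b%:C%C *: param_y z.
  by apply/colP => i; apply/eqP; rewrite eq_complex !mxE ReM ImM /= !mul0r subr0 addr0 !eqxx.
have pvecZ : pvec (a%:C%C *: param_x z) (b%:C%C *: param_y z) =
    (a * b)%:C%C *: pvec (param_x z) (param_y z).
  by apply/colP => i; rewrite !mxE rmorphM /=; ring.
rewrite /param_outer rx ry pvecZ trmxCZ -scalemxAl -scalemxAr scalerA; congr (_ *: _).
by apply/eqP; rewrite eq_complex !(ReM, ImM, ReJ, ImJ) /=; apply/andP; split; apply/eqP; ring.
Qed.

Lemma continuous_coord_param j : continuous (fun z => coord (param_outer z) j).
Proof.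
have ccw a : cplx_continuous (fun z : T => pvec (param_x z) (param_y z) a 0).
  rewrite (_ : (fun z => _) = (fun z => param_x z (mxtens_unindex a).1 0 *
      param_y z (mxtens_unindex a).2 0)); last by apply/funext => z; rewrite mxE.
  apply: cplx_continuousM; split.
  - rewrite (_ : _ \o _ = (fun z : T => z (inl ((mxtens_unindex a).1, true)))).
      exact: (@proj_continuous _ (fun _ : I => R)).
    by apply/funext => z; rewrite /= mxE.
  - rewrite (_ : _ \o _ = (fun z : T => z (inl ((mxtens_unindex a).1, false)))).
      exact: (@proj_continuous _ (fun _ : I => R)).
    by apply/funext => z; rewrite /= mxE.
  - rewrite (_ : _ \o _ = (fun z : T => z (inr ((mxtens_unindex a).2, true)))).
      exact: (@proj_continuous _ (fun _ : I => R)).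
    by apply/funext => z; rewrite /= mxE.
  - rewrite (_ : _ \o _ = (fun z : T => z (inr ((mxtens_unindex a).2, false)))).
      exact: (@proj_continuous _ (fun _ : I => R)).
    by apply/funext => z; rewrite /= mxE.
have [cr ci] : cplx_continuous (fun z : T => param_outer z j.1.1 j.1.2).
  rewrite (_ : (fun z => _) = fun z => pvec (param_x z) (param_y z) j.1.1 0 *
      (pvec (param_x z) (param_y z) j.1.2 0)^*).
    exact: cplx_continuousM (cplx_continuousJ _).
  by apply/funext => z; rewrite mxE big_ord1 [_ ^t* _ _]mxE [_^T _ _]mxE.
by rewrite /coord; case: j.2.
Qed.

Lemma tr_param z : re (\tr (param_outer z)) =
  (\sum_i z (inl i) ^+ 2) * (\sum_i z (inr i) ^+ 2).
Proof.
rewrite Re_sum sum_tens.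
rewrite !sum_pair.
rewrite big_distrlr; apply: eq_bigr => i _; apply: eq_bigr => p _ /=.
rewrite !big_bool mxE big_ord1 [_ ^t* _ _]mxE [_^T _ _]mxE !pvecE !mxE.
rewrite !(ReM, ImM, ReJ, ImJ) /=; ring.
Qed.

(** The bound |x|^2 |y|^2 <= M alone lets x grow while y shrinks; normalizing y to length 1 leaves
    the matrix unchanged and gives |x|^2 <= M. *)
Lemma param_proper (M : R) : exists2 B : set T, compact B &
  forall z, re (\tr (param_outer z)) <= M ->
    exists2 z', B z' & forall j, coord (param_outer z') j = coord (param_outer z) j.
Proof.
pose L := `|M| + 1.
exists [set z : T | forall i, `[- L, L]%classic (z i)].
  apply: (@tychonoff _ (fun _ : I => R) (fun=> `[- L, L]%classic)) => _.
  exact: segment_compact.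
have sqrL (u : R) : u ^+ 2 <= `|M| \/ u ^+ 2 <= 1 -> `[- L, L]%classic u.
  move=> u2; rewrite /= in_itv /= -ler_norml /L.
  have M0 := normr_ge0 M; have u0 := normr_ge0 u.
  by rewrite -(real_normK (num_real u)) in u2; case: u2 => u2; nra.
move=> z; rewrite tr_param; set X := \sum_i _; set Y := \sum_i _ => XY.
have sqX i : z (inl i) ^+ 2 <= X.
  by rewrite /X (bigD1 i) //= lerDl sumr_ge0 // => ? _; apply: sqr_ge0.
have sqY i : z (inr i) ^+ 2 <= Y.
  by rewrite /Y (bigD1 i) //= lerDl sumr_ge0 // => ? _; apply: sqr_ge0.
have Y0 : 0 <= Y by apply: sumr_ge0 => ? _; apply: sqr_ge0.
(* If y = 0 the matrix vanishes, and x is replaced by 0. *)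
have [eY|Yn0] := eqVneq Y 0.
  have zr0 i : z (inr i) = 0.
    by apply/eqP; rewrite -sqrf_eq0 eq_le sqr_ge0 andbT -eY.
  have outer0 : param_outer z = 0.
    rewrite /param_outer (_ : pvec _ _ = 0) ?mul0mx //.
    by apply/colP => a; rewrite !mxE !zr0 mulr0.
  exists (rescale 0 1 z) => [i|j]; last by rewrite param_rescale outer0 scaler0.
  apply: sqrL; right; case: i => i; rewrite /= ?mul0r ?zr0 ?mulr0 expr0n.
    exact: ler01.
  exact: ler01.
have sY : 0 < Num.sqrt Y by rewrite sqrtr_gt0 lt_def Yn0.
exists (rescale (Num.sqrt Y) (Num.sqrt Y)^-1 z) => [i|j]; last first.
  by rewrite param_rescale mulfV ?gt_eqF // expr1n scale1r.
apply: sqrL; case: i => i /=; rewrite exprMn.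
  left; rewrite sqr_sqrtr // mulrC; apply: le_trans (ler_norm M).
  by apply: le_trans XY; apply: ler_wpM2r.
right; rewrite exprVn sqr_sqrtr // mulrC ler_pdivrMr ?mul1r //.
by rewrite lt_def Yn0.
Qed.

End Params.

(** [conic_farkas] applied to the pure products, with the trace as tau: a separating form would give
    some H in C^min with tr (H A) < 0. *)
Lemma Dmax_dual n k (A : 'M[C]_(n * k)) :
  (forall H, cone_min k n H -> 0 <= \tr (H *m A)) -> Dmax A.
Proof.
move=> dualA.
(* Rank one positive matrices lie in C^min, so the hypothesis already makes A positive. *)
have [hermA _] : psdmx A.
  apply/psdmxP => w; rewrite quad_tr mxtrace_mulC.
  exact/dualA/psd_cone_min/psdmx_outer.
have {}hermA : A ^t* = A by move/is_hermitianmxP: hermA; rewrite expr0 scale1r => <-.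
pose T := prod_topology (fun _ : 'I_n * bool + 'I_k * bool => R).
pose G (z : T) := coord (param_outer z).
have Gscale (c : R) z : 0 <= c -> exists z', forall j, G z' j = c * G z j.
  move=> c0; exists (rescale (Num.sqrt c) 1 z) => j.
  by rewrite /G param_rescale mulr1 sqr_sqrtr // coordZ.
pose tau (j : 'I_(n * k) * 'I_(n * k) * bool) : R := coord 1%:M j.
have tauE (B : 'M[C]_(n * k)) : \sum_j tau j * coord B j = re (\tr B).
  rewrite form_mxE (_ : form_mx tau = 1%:M) ?mul1mx //.
  apply/matrixP => a b; rewrite !mxE eq_sym; apply/eqP.
  rewrite eq_complex /tau /coord /= !mxE.
  by case: (b == a); rewrite /= ?oppr0 !eqxx.
have tr_ge0 z : 0 <= \sum_j tau j * G z j.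
  by rewrite tauE tr_param mulr_ge0 // sumr_ge0 // => i _; exact: sqr_ge0.
have tr_proper (M : R) : exists2 B : set T, compact B &
    forall z, \sum_j tau j * G z j <= M ->
    exists2 z', B z' & forall j, G z' j = G z j.
  have [B cB hB] := @param_proper n k M; exists B => // z.
  by rewrite tauE; apply: hB.
have [[q [Z E]]|[y [y0 yA]]] := @conic_farkas R _ T G (fun=> 0)
    (@continuous_coord_param n k) Gscale tau tr_ge0 tr_proper (coord A).
  exists q, (fun l => param_x (Z l) *m (param_x (Z l)) ^t*),
    (fun l => param_y (Z l) *m (param_y (Z l)) ^t*).
  split=> [l|l|]; [exact: psdmx_outer|exact: psdmx_outer|].
  apply: coord_inj => j; rewrite E coord_sum; apply: eq_bigr => l _.
  by rewrite tensmx_outer.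
(* On hermitian matrices tr (H B) is twice Re tr ([form_mx y] B), which makes the separation complex
   valued. *)
pose H := form_mx y + (form_mx y) ^t*.
have minH : cone_min k n H.
  apply/cone_minP => u v; have [z [zu zv]] := param_surj u v.
  have := y0 z; rewrite form_mxE /param_outer zu zv => q0.
  rewrite quad_tr mulmxDl raddfD /= tr_ctrmxM ?addJ_Re ?ler0c ?mulrn_wge0 //.
  by rewrite trmxCM trmxCK.
have := dualA _ minH; rewrite mulmxDl raddfD /= tr_ctrmxM // addJ_Re ler0c.
by rewrite pmulrn_lge0 // -form_mxE leNgt yA.
Qed.
End Separation.

Theorem theorem6p10 (R : realType) (k m : nat)
    (phi : 'Hom('M[R[i]]_k, 'M[R[i]]_m)) :
  [<->
    completely_positive (cone_min k) (cone_usual m) phi;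
    entanglement_breaking phi;
    co_entanglement_breaking phi;
    completely_positive (cone_usual k) (cone_max m) phi;
    exists (K : nat) (s : 'I_K -> functional R[i] k) (P : 'I_K -> 'M[R[i]]_m),
      [/\ forall l, positive_functional (s l), forall l, psdmx (P l)
        & forall X : 'M[R[i]]_k, phi X = \sum_(l < K) (s l X : R[i]) *: P l];
    exists (N : nat) (A : 'I_N -> 'M[R[i]]_(k, m)),
      (forall l, \rank (A l) = 1%N) /\
      (forall X : 'M[R[i]]_k, phi X = \sum_(l < N) (A l) ^t* *m X *m A l);
    completely_positive (cone_min k) (cone_max m) phi].
Proof.
tfae.
- move=> cp; apply/holevo_eb/holevo_of_choi/Dmax_dual => H minH.
  exact: cp_min_choi.
- by move=> /eb_holevo/holevo_flat/holevo_eb.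
(* Transposing twice transfers the Holevo form of [flat phi] back to phi. *)
- move=> /eb_holevo/holevo_flat; rewrite flatK => /holevo_cp cp n A psdA.
  exact/cp/psd_cone_min.
- move=> cp; apply/holevo_of_choi/Dmax_dual => H minH.
  apply: cone_max_pairing => //.
  (* The Choi matrix is the image under phi_k of a positive matrix, so (iv) puts it in C^max. *)
  have -> : choi phi = ampl k phi (max_entangled R[i] k *m (max_entangled R[i] k) ^t*).
    rewrite amplE; apply/matrixP => a b; rewrite !mxE; congr ((phi _) _ _).
    apply/matrixP => p q; rewrite !mxE big_ord1 !mxE !mxtens_indexK /=.
    by rewrite conjC_nat -natrM mulnb !(eq_sym _ p) !(eq_sym _ q).
  exact/cp/psdmx_outer.
- exact: holevo_kraus1.
- by move=> /kraus1_holevo/holevo_cp.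
- by move=> cp n A /cp/cone_max_psd.
Qed.
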